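(* For every integer $n\ge 16$, $$s(n)\ \ge\ 3^{\,0.811\cdot\sqrt{\log_3 (n+1)}}.$$
   Context: Let $[n]=\{1,\ldots,n\}$ and let $\mathcal{S}_n$ be the set of all permutations of $[n]$, written as sequences $\mathbf{x}=x_1\ldots x_n$. For $1\le k\le n$, a $k$-minor of $\mathbf{x}\in\mathcal{S}_n$ is a subsequence of $\mathbf{x}$ of length $k$ (entries taken in increasing index positions) whose entries are renumbered by $1,2,\ldots,k$ preserving their relative order; it is thus an element of $\mathcal{S}_k$. The $k$-deck $D_k(\mathbf{x})$ is the multiset of all $\binom{n}{k}$ $k$-minors of $\mathbf{x}$ (one for each choice of $k$ index positions). A permutation $\mathbf{x}\in\mathcal{S}_n$ is $k$-reconstructible if no $\mathbf{y}\in\mathcal{S}_n$ with $\mathbf{y}\ne\mathbf{x}$ satisfies $D_k(\mathbf{y})=D_k(\mathbf{x})$. For a positive integer $n$, $s(n)$ denotes the least positive integer $k\le n$ such that every $\mathbf{x}\in\mathcal{S}_n$ is $k$-reconstructible. *)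

(* Defs.v *)
From HB Require Import structures.
From mathcomp Require Import all_boot all_order all_algebra.
From mathcomp Require Import reals exp.
Set Implicit Arguments.
Unset Strict Implicit.
Unset Printing Implicit Defensive.
Import Order.TTheory GRing.Theory Num.Theory.

(* Permutations of {1, ..., n} in one-line notation x_1 ... x_n. *)
Definition symn (n : nat) : seq (seq nat) := permutations (iota 1 n).

(* Renumber the (distinct) entries of s by 1, ..., size s, preserving their
   relative order: see [std_symn] and [std_ltn]. *)
Definition std (s : seq nat) : seq nat :=
  [seq (count (fun b => b < a) s).+1 | a <- s].

(* Positions are 0-based; [enum A] lists them in increasing order. *)
Definition minor (x : seq nat) (A : {set 'I_(size x)}) : seq nat :=
  std [seq nth 0 x (val i) | i <- enum A].
Arguments minor : clear implicits.

(* Multisets are represented by sequences, and compared with [perm_eq]. *)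
Definition deck (k : nat) (x : seq nat) : seq (seq nat) :=
  [seq minor x A | A : {set 'I_(size x)} <- enum {set 'I_(size x)} & #|A| == k].

Definition reconstructible (n k : nat) (x : seq nat) : bool :=
  all (fun y => (y != x) ==> ~~ perm_eq (deck k y) (deck k x)) (symn n).

(* The least k in {1, ..., n} such that every permutation is k-reconstructible:
   see [recon_numP]. The default value 0 is only taken for n = 0. *)
Definition recon_num (n : nat) : nat :=
  head 0 [seq k <- iota 1 n | all (reconstructible n k) (symn n)].

Definition log3 (R : realType) (t : R) : R := (ln t / ln 3)%R.

Lemma std_ltn (s : seq nat) (i j : nat) : i < size s -> j < size s ->
  (nth 0 (std s) i < nth 0 (std s) j) = (nth 0 s i < nth 0 s j).
Proof.
move=> hi hj; rewrite !(nth_map 0) // ltnS.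
have [ltij|leji] := ltnP (nth 0 s i) (nth 0 s j); last first.
  by apply/negbTE; rewrite -leqNgt; apply: sub_count => b /= /leq_trans; apply.
set a := nth 0 s i in ltij *; set c := nth 0 s j in ltij *.
have -> : count (fun b => b < c) s =
    count (fun b => b < a) s + count (fun b => a <= b < c) s.
  rewrite -count_predUI [X in _ = _ + X](_ : _ = 0) ?addn0.
    apply: eq_count => b /=; case: (ltnP b a) => //= ba.
    exact: ltn_trans ba ltij.
  by apply/eqP; rewrite -leqn0 leqNgt -has_count; apply/hasPn => b _ /=;
    case: (ltnP b a).
rewrite -addn1 leq_add2l -has_count; apply/hasP; exists a => /=.
  exact: mem_nth.
by rewrite leqnn.
Qed.

Lemma std_symn (s : seq nat) : uniq s -> std s \in symn (size s).
Proof.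
move=> us; have sz : size (std s) = size s by rewrite size_map.
rewrite mem_permutations; have ustd : uniq (std s).
  apply/(uniqP 0) => i j; rewrite !inE sz => hi hj eqij; apply/eqP.
  rewrite -(nth_uniq 0 hi hj us) eqn_leq.
  rewrite (leqNgt (nth 0 s i)) (leqNgt (nth 0 s j)).
  by rewrite -(std_ltn hi hj) -(std_ltn hj hi) eqij ltnn.
apply: uniq_perm; rewrite ?iota_uniq //.
apply: (uniq_min_size ustd _ _).2; last by rewrite size_iota sz.
move=> _ /mapP[a sa ->]; rewrite mem_iota add1n /= ltnS.
rewrite -(count_predC (fun b => b < a) s) -addn1 leq_add2l -has_count.
by apply/hasP; exists a; rewrite //= ltnn.
Qed.

Lemma minor_symn (n k : nat) (x : seq nat) (z : seq nat) :
  x \in symn n -> z \in deck k x -> z \in symn k.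
Proof.
rewrite mem_permutations => px /mapP[A]; rewrite mem_filter => /andP[/eqP cA _].
move=> ->; rewrite /minor.
rewrite (_ : k = size [seq nth 0 x (val i) | i <- enum A]); last first.
  by rewrite size_map -cardE.
apply: std_symn; rewrite map_inj_uniq ?enum_uniq // => i j /eqP.
by rewrite nth_uniq ?ltn_ord ?(perm_uniq px) ?iota_uniq // => /eqP/val_inj.
Qed.

Lemma size_deck (k : nat) (x : seq nat) : size (deck k x) = 'C(size x, k).
Proof.
rewrite size_map -[size x in RHS]card_ord -card_draws cardE enumT.
by rewrite /enum_mem !size_filter; apply: eq_count => A /=; rewrite !inE.
Qed.

Lemma std_id (n : nat) (x : seq nat) : x \in symn n -> std x = x.
Proof.
rewrite mem_permutations => px; rewrite -[RHS]map_id; apply/eq_in_map => a.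
rewrite (perm_mem px) mem_iota add1n => /andP[a0 an].
rewrite (permP px) -size_filter (_ : filter _ _ = iota 1 a.-1).
  by rewrite size_iota prednK.
apply: (irr_sorted_eq ltn_trans ltnn).
- by rewrite sorted_filter ?iota_ltn_sorted //; exact: ltn_trans.
- exact: iota_ltn_sorted.
move=> b; rewrite mem_filter !mem_iota !add1n prednK //.
by case: (ltnP b a) => ba; rewrite ?andbT ?andbF //= (ltn_trans ba) ?andbT.
Qed.

Lemma deck_full (n : nat) (x : seq nat) : x \in symn n -> deck n x = [:: x].
Proof.
move=> hx; have sx : size x = n.
  by move: hx; rewrite mem_permutations => /perm_size; rewrite size_iota.
have h z : z \in deck n x -> z = x.
  case/mapP => A; rewrite mem_filter => /andP[/eqP cA _] ->.
  have -> : A = [set: 'I_(size x)].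
    by apply/eqP; rewrite eqEcard subsetT cardsT card_ord cA sx /=.
  rewrite /minor enum_setT -enumT (map_comp (nth 0 x) val) val_enum_ord.
  by rewrite -/(mkseq _ _) mkseq_nth (std_id hx).
have := size_deck n x; rewrite sx binn.
case: (deck n x) h => [|z [|]] //= h _; congr (_ :: _).
by apply: h; rewrite mem_head.
Qed.

Lemma recon_numP (n : nat) : 0 < n ->
  [/\ 0 < recon_num n <= n,
      all (reconstructible n (recon_num n)) (symn n)
    & forall k, 0 < k <= n -> all (reconstructible n k) (symn n) ->
      recon_num n <= k].
Proof.
move=> n0; rewrite /recon_num.
set P := fun k => all (reconstructible n k) (symn n).
have Pn : P n.
  apply/allP => x hx; apply/allP => y hy; apply/implyP => neq.
  rewrite !deck_full //; apply: contra neq => /perm_mem/(_ y).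
  by rewrite !inE eqxx => <-.
have memF k : (k \in [seq k <- iota 1 n | P k]) = P k && (0 < k <= n).
  by rewrite mem_filter mem_iota add1n ltnS.
have : sorted ltn [seq k <- iota 1 n | P k].
  by rewrite sorted_filter ?iota_ltn_sorted //; exact: ltn_trans.
case: [seq k <- iota 1 n | P k] memF => [|m t] memF /=.
  by have := memF n; rewrite Pn n0 leqnn.
move=> /(order_path_min ltn_trans)/allP hm.
have := memF m; rewrite mem_head => /esym/andP[Pm hmn]; split=> // k hk Pk.
rewrite -/(P k) in Pk; have := memF k; rewrite Pk hk inE => /orP[/eqP->//|/hm/ltnW //].
Qed.

(* Main.v *)
Require Import Defs.
From mathcomp Require Import all_boot all_order all_algebra.
From mathcomp Require Import reals sequences exp.
From mathcomp Require Import ring lra zify.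
Set Implicit Arguments.
Unset Strict Implicit.
Unset Printing Implicit Defensive.
Import Order.TTheory GRing.Theory Num.Theory.
Local Open Scope ring_scope.

(** A word over two letters encodes a permutation: the positions of the letter
false receive the small values in increasing order, and the positions of true
the large ones, also increasing.  A minor of this permutation is the
permutation of the corresponding subword, so two words of length n in which
every word of length at most k occurs equally often as a subsequence give two
permutations with the same k-deck ([deck_word_perm]).  It remains to find,
for each k, a short pair of distinct words with this property ([ambiguous]).
The theorem follows from a length N with
log_3 N <= 1.52 (log_3 k)^2 ([ambiguous_within]), since 1.52 * 0.811^2 < 1; the
values k <= 4 are covered by the assumption n >= 16.

The pairs come from a recursion that passes from k to 3k+2.  Let x and y have
the same length and the same k-deck, and replace in a word w of length L each
letter by x or y.  A subsequence of length at most 3k+2 meets at most two of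
the blocks in more than k letters, so the (3k+2)-deck of the result depends on
w only through statistics of single positions and of pairs of positions of the
letter true.  Since the number of ways to place the rest of the subsequence in
the remaining blocks is a product of binomial coefficients, these statistics
are the binomial moments of degree at most 2k+1 and the double moments of total
degree at most k ([prod_expansion], [deck_eq_inflate]).  Multiplying two
moments expresses the double moments with exponents (c, a) by those with
exponents (a, c), so that half of them suffice ([moment2_sym]); without this
factor of two, L would be too large for the constant 0.811.  About k^2 / 4 double moments
are left, which together take about (k^3 / 6) log_2 (L / k) bits, hence by the
pigeonhole principle two words of length L about (k^3 / 3) log_2 k share all of
them ([ambiguous_triple]).

Iterating, log_3 N grows like (3/2) (log_3 k)^2, and the logarithmic factor in L
is absorbed by the difference between 1.5 and 1.52: a step costs
L <= 3^1.52 k^3.04, which is enough from k = 18 on ([large_step_ineq]).  Smaller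
k start from an explicit pair of length 32 with the same 6-deck
([ambiguous_6_32]), whose length doubles each time k grows by one
([ambiguous_double]). *)

(** * Words and their decks *)

(** The number of occurrences of u in w as a subsequence (a binomial coefficient
of words). *)
Fixpoint occ (w u : seq bool) : nat :=
  if w is a :: w' then
    (occ w' u + (if u is b :: u' then (a == b) * occ w' u' else 0))%N
  else nilp u.

Definition deck_eq (k : nat) (w w' : seq bool) :=
  forall u, (size u <= k)%N -> occ w u = occ w' u.

Definition letter_mx (u : seq bool) (a : bool) : 'M[int]_((size u).+1) :=
  \matrix_(i, j) ((j == i.+1 :> nat) && (nth false u i == a))%:R.

(** Occurrences of the factors of u multiply under concatenation like the
entries of a unitriangular matrix: [occ_mxE] identifies the entry (i, j) of
[occ_mx u w] as the number of occurrences in w of the factor of u between the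
positions i and j.  The product form makes [occ_mx u] a monoid morphism. *)
Definition occ_mx (u w : seq bool) : 'M[int]_((size u).+1) :=
  \prod_(a <- w) (1 + letter_mx u a).

Lemma occ_mxE u w (i j : 'I_(size u).+1) :
  occ_mx u w i j = if (i <= j)%N then (occ w (take (j - i) (drop i u)))%:R else 0.
Proof.
elim: w i j => [|a w IHw] i j.
  rewrite /occ_mx big_nil mxE /= -val_eqE /=.
  have [lij|lji] := leqP i j; last by rewrite gtn_eqF.
  rewrite /nilp size_take_min size_drop; congr (_%:R : int).
  congr nat_of_bool; have ju := ltn_ord j.
  by apply/eqP/eqP; lia.
rewrite /occ_mx big_cons -/(occ_mx u w) mulrDl mul1r mxE IHw /=.
have -> : (letter_mx u a * occ_mx u w) i j =
    ((i < j) && (nth false u i == a))%N%:R *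
      (occ w (take (j - i.+1) (drop i.+1 u)))%:R.
  rewrite mxE; have [lij|leji] := ltnP i j; last first.
    rewrite mul0r big1 // => l _; rewrite mxE IHw.
    by case: eqP => [->|]; rewrite ?mul0r // leqNgt ltnS leji mulr0.
  have iu : (i.+1 < (size u).+1)%N by apply: leq_ltn_trans lij (ltn_ord j).
  rewrite (bigD1 (Ordinal iu)) //= big1 ?addr0 => [|l nl]; last first.
    rewrite mxE; case: eqP => [eql|]; rewrite ?mul0r //.
    by case/eqP: nl; apply: val_inj.
  by rewrite mxE IHw /= eqxx lij.
have [lij|lji] := leqP i j; last first.
  by rewrite ltnNge ltnW //= mul0r addr0.
rewrite natrD; congr (_ + _); have [ltij|] := ltnP i j; last first.
  by move=> leji; rewrite (_ : (j - i = 0)%N) ?take0 ?mul0r //; apply/eqP.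
have iu : (i < size u)%N by have := ltn_ord j; lia.
rewrite (drop_nth false iu) -(subnSK ltij) /= natrM eq_sym.
by congr (_%:R * _); case: (_ == _).
Qed.

Lemma occ_mx_corner u w : occ_mx u w ord0 ord_max = (occ w u)%:R.
Proof. by rewrite occ_mxE /= drop0 subn0 take_size. Qed.

Lemma deck_eq_mx k w w' :
  (forall u, (size u <= k)%N -> occ_mx u w = occ_mx u w') -> deck_eq k w w'.
Proof.
move=> eqmx u /eqmx eqM; apply/eqP; rewrite -(eqr_nat int).
by rewrite -!occ_mx_corner eqM.
Qed.

Lemma occ_mx_cat u w w' : occ_mx u (w ++ w') = occ_mx u w * occ_mx u w'.
Proof. exact: big_cat. Qed.

(** * The filtration of square matrices by distance to the diagonal *)

Section Filtration.
Context {n : nat}.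
Implicit Types (X Y : 'M[int]_n.+1) (a b : nat).

(** The entries of X vanish below the a-th diagonal above the main one.  On the
matrices [occ_mx u w] this filters by length of subsequence: the entry (i, j)
counts a word of length j - i. *)
Definition above a X := forall i j : 'I_n.+1, (j < i + a)%N -> X i j = 0.

Lemma aboveD a X Y : above a X -> above a Y -> above a (X + Y).
Proof. by move=> hX hY i j ij; rewrite mxE hX ?hY ?addr0. Qed.

Lemma aboveN a X : above a X -> above a (- X).
Proof. by move=> hX i j ij; rewrite mxE hX ?oppr0. Qed.

Lemma aboveM a b X Y : above a X -> above b Y -> above (a + b) (X * Y).
Proof.
move=> hX hY i j ij; rewrite mxE big1 // => l _.
have [lia_|lal] := ltnP l (i + a); first by rewrite hX ?mul0r.
by rewrite hY ?mulr0 //; lia.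
Qed.

Lemma aboveW a b X : (b <= a)%N -> above a X -> above b X.
Proof. by move=> leba hX i j ij; apply: hX; lia. Qed.

Lemma above1 : above 0 1.
Proof. by move=> i j ij; rewrite mxE -val_eqE /=; case: eqP => //; lia. Qed.

Lemma aboveX a X m : above a X -> above (a * m) (X ^+ m).
Proof.
move=> hX; elim: m => [|m IHm]; first by rewrite muln0 expr0; apply: above1.
by rewrite mulnS exprS; apply: aboveM.
Qed.

Lemma above_eq0 a X : (n < a)%N -> above a X -> X = 0.
Proof.
by move=> na hX; apply/matrixP => i j; rewrite mxE hX //; have := ltn_ord j; lia.
Qed.

Lemma above_sum a I (r : seq I) (P : pred I) (F : I -> 'M[int]_n.+1) :
  (forall i, P i -> above a (F i)) -> above a (\sum_(i <- r | P i) F i).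
Proof.
by move=> hF; apply: big_ind => // [i j _|X Y]; [rewrite mxE | apply: aboveD].
Qed.

(** The inverse of a unitriangular matrix is a finite geometric series. *)
Lemma above_inv X : above 1 (X - 1) ->
  exists Y, [/\ X * Y = 1, Y * X = 1 & above 0 Y].
Proof.
move=> hX; pose Y := \sum_(i < n.+1) (1 - X) ^+ i.
have h1 : above 1 (1 - X) by rewrite -opprB; apply: aboveN.
have XY : X * Y = 1.
  have := subrX1 (1 - X) n.+1; rewrite (above_eq0 _ (aboveX (m := n.+1) h1)) ?mul1n //.
  rewrite sub0r (_ : 1 - X - 1 = - X); last by rewrite addrAC subrr add0r.
  by rewrite mulNr => /oppr_inj.
exists Y; split=> //; first exact: mulmx1C.
by apply: above_sum => i _; apply: aboveW (aboveX h1).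
Qed.

End Filtration.

Lemma above_occ_mx1 u w : above 1 (occ_mx u w - 1).
Proof.
move=> i j ij; rewrite !mxE occ_mxE -val_eqE /=.
case: (ltngtP i j) => [|_|->]; rewrite ?subr0 //; first by lia.
rewrite subnn take0 (_ : occ w [::] = 1%N) ?subrr //.
by elim: w => //= a w ->.
Qed.

Lemma above_deck_eq k u w w' :
  deck_eq k w w' -> above k.+1 (occ_mx u w - occ_mx u w').
Proof.
move=> eqw i j ij; rewrite !mxE !occ_mxE; case: leqP => lij; rewrite ?subrr //.
rewrite eqw ?subrr // size_take_min size_drop; lia.
Qed.

(** With P = Q + D, the commutator PQ - QP is D(Q - 1) - (Q - 1)D, where Q - 1
gains one diagonal over D. *)
Lemma deck_eq_swap k x y : deck_eq k x y -> deck_eq k.+1 (x ++ y) (y ++ x).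
Proof.
move=> eqxy; apply: deck_eq_mx => u le_uk; rewrite !occ_mx_cat.
have hD := above_deck_eq (u := u) eqxy; have hX := @above_occ_mx1 u y.
move: (occ_mx u x) (occ_mx u y) hD hX => P Q hD hX.
apply/eqP; rewrite -subr_eq0; apply/eqP.
have -> : P * Q - Q * P = (P - Q) * (Q - 1) - (Q - 1) * (P - Q).
  rewrite !(mulrBl, mulrBr) !(mul1r, mulr1).
  move: (P * Q) (Q * Q) (Q * P) => a b c.
  by apply/matrixP => i j; rewrite !mxE; ring.
apply: (@above_eq0 _ k.+2); first by rewrite ltnS.
by apply: aboveD; [rewrite -addn1 | apply: aboveN; rewrite -add1n]; apply: aboveM.
Qed.

(** * The expansion of a word in two kinds of blocks *)

(** Binomial moments of the set of the positions where f is true, and of the set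
of pairs i < j of such positions. *)
Definition moment (f : nat -> bool) (l a : nat) : nat :=
  (\sum_(i < l) f i * 'C(i, a))%N.

Definition moment2 (f : nat -> bool) (l a c : nat) : nat :=
  (\sum_(j < l) f j * 'C(j, c) * moment f j a)%N.

Section Expansion.
Context {n k : nat}.
Context (n_le : (n <= 3 * k + 2)%N).
Context (M D Mi : 'M[int]_n.+1) (MMi : M * Mi = 1) (MiM : Mi * M = 1).
Context (upM : above 1 (M - 1)) (upMi : above 0 Mi) (upD : above k.+1 D).

(** Iterated differences of conjugation by M, starting from D M^-1.  Each
difference is a commutator with M, hence lies one diagonal higher. *)
Definition conj_diff (a : nat) : 'M[int]_n.+1 :=
  iter a (fun T => M * T * Mi - T) (D * Mi).

Lemma conj_diffS a :
  conj_diff a.+1 = M * conj_diff a * Mi - conj_diff a.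
Proof. by []. Qed.

Lemma above_conj_diff a : above (k.+1 + a) (conj_diff a).
Proof.
elim: a => [|a IHa]; first exact: aboveM.
rewrite conj_diffS.
have -> : M * conj_diff a * Mi - conj_diff a =
    ((M - 1) * conj_diff a - conj_diff a * (M - 1)) * Mi.
  rewrite !mulrBl mulrBr !mul1r mulr1 mulrBl -(mulrA (conj_diff a)) MMi mulr1.
  by rewrite opprB addrA subrK.
rewrite -[(_ + a.+1)%N]addn0; apply: aboveM => //.
apply: aboveD; first by rewrite addnS -add1n; apply: aboveM.
by apply: aboveN; rewrite addnS -addn1; apply: aboveM.
Qed.

Lemma conj_diff0 a : (2 * k + 2 <= a)%N -> conj_diff a = 0.
Proof. by move=> le_a; apply: (above_eq0 _ (@above_conj_diff a)); lia. Qed.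

Let N := (2 * k + 2)%N.

(** Newton's expansion of the i-th conjugate of D M^-1 in binomial coefficients;
it stops because the differences of high order vanish. *)
Lemma conj_power i :
  M ^+ i * (D * Mi) * Mi ^+ i = \sum_(a < N) conj_diff a *+ 'C(i, a).
Proof.
elim: i => [|i IHi].
  rewrite expr0 mul1r mulr1 /N addn2 big_ord_recl bin0 mulr1n big1 ?addr0 //.
have -> : M ^+ i.+1 * (D * Mi) * Mi ^+ i.+1 =
    M * (M ^+ i * (D * Mi) * Mi ^+ i) * Mi by rewrite exprS exprSr !mulrA.
rewrite IHi mulr_sumr mulr_suml.
have shift j : \sum_(a < N) conj_diff a *+ 'C(j, a) =
    conj_diff 0 + \sum_(a < N) conj_diff a.+1 *+ 'C(j, a.+1).
  transitivity (\sum_(a < N.+1) conj_diff a *+ 'C(j, a)).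
    by rewrite big_ord_recr /= conj_diff0 // mul0rn addr0.
  by rewrite big_ord_recl bin0 mulr1n.
rewrite shift.
transitivity (\sum_(a < N) (conj_diff a *+ 'C(i, a) + conj_diff a.+1 *+ 'C(i, a))).
  apply: eq_bigr => a _; rewrite conj_diffS mulrnBl addrC subrK.
  by rewrite mulrnAr mulrnAl.
rewrite big_split /= shift -addrA -big_split /=; congr (_ + _).
by apply: eq_bigr => a _; rewrite -mulrnDr binS.
Qed.

(** Moving all factors M to the right turns the product into M^l preceded by the
product of the 1 + E_i over the positions i of the letter true, with E_i the
i-th conjugate of D M^-1.  A product of three E_i lies above the diagonal
3k + 2 and vanishes, so only sums over single positions and over pairs
remain. *)
Lemma prod_expansion (f : nat -> bool) l :
  \prod_(i < l) (M + D *+ f i) =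
  (1 + \sum_(a < N) conj_diff a *+ moment f l a +
     \sum_(a < N) \sum_(c < N)
        conj_diff a * conj_diff c *+ moment2 f l a c) * M ^+ l.
Proof.
have MX i : Mi ^+ i * M ^+ i = 1.
  elim: i => [|i IHi]; first by rewrite !expr0 mulr1.
  by rewrite exprSr exprS mulrA -(mulrA _ Mi) MiM mulr1 IHi.
elim: l => [|l IHl].
  rewrite big_ord0 expr0 mulr1 !big1 ?addr0 // => a _.
    by rewrite big1 // => c _; rewrite /moment2 big_ord0.
  by rewrite /moment big_ord0.
rewrite big_ord_recr /= IHl; set S1 := \sum_(a < N) _; set S2 := \sum_(a < N) _.
have S1S : \sum_(a < N) conj_diff a *+ moment f l.+1 a =
    S1 + (M ^+ l * (D * Mi) * Mi ^+ l) *+ f l.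
  rewrite conj_power -sumrMnl -big_split /=; apply: eq_bigr => a _.
  by rewrite /moment big_ord_recr /= mulrnDr mulnC mulrnA.
have S2S : \sum_(a < N) \sum_(c < N)
      conj_diff a * conj_diff c *+ moment2 f l.+1 a c =
    S2 + S1 * (M ^+ l * (D * Mi) * Mi ^+ l) *+ f l.
  rewrite conj_power -mulrnAl -sumrMnl mulr_suml -big_split /=.
  apply: eq_bigr => a _; rewrite mulr_sumr -big_split /=; apply: eq_bigr => c _.
  rewrite /moment2 big_ord_recr /= mulrnDr; congr (_ + _).
  by rewrite -!mulrnA mulrnAl mulrnAr -!mulrnA; congr (_ *+ _); lia.
have S20 : S2 * (M ^+ l * (D * Mi) * Mi ^+ l) = 0.
  apply: (@above_eq0 _ ((k.+1 + k.+1) + k.+1)); first by lia.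
  apply: aboveM.
    apply: above_sum => a _; apply: above_sum => c _.
    move: (moment2 _ _ _ _) => m; elim: m => [|m IHm].
      by rewrite mulr0n => i j _; rewrite mxE.
    rewrite mulrS; apply: aboveD => //; apply: aboveM.
      by apply: aboveW (@above_conj_diff a); lia.
    by apply: aboveW (@above_conj_diff c); lia.
  rewrite conj_power; apply: above_sum => a _.
  move: 'C(l, a) => m; elim: m => [|m IHm].
    by rewrite mulr0n => i j _; rewrite mxE.
  rewrite mulrS; apply: aboveD => //.
  by apply: aboveW (@above_conj_diff a); lia.
rewrite S1S S2S -[in LHS]mulrA.
have -> : M ^+ l * (M + D *+ f l) =
    (1 + (M ^+ l * (D * Mi) * Mi ^+ l) *+ f l) * M ^+ l.+1.
  rewrite mulrDr mulrDl mul1r -exprSr; congr (_ + _).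
  rewrite mulrnAr mulrnAl; congr (_ *+ _).
  by rewrite exprSr -!mulrA (mulrA (Mi ^+ l)) MX mul1r MiM mulr1.
rewrite mulrA; congr (_ * _).
move: (M ^+ l * _ * _) S20 => E S20.
rewrite mulrDr mulr1 !mulrDl mul1r [S2 * _]mulrnAr S20 mul0rn addr0.
rewrite [S1 * (E *+ _)]mulrnAr; move: (E *+ _) (S1 * E *+ _) => x y.
by apply/matrixP => i j; rewrite !mxE; ring.
Qed.

Lemma eq_prod_moments (f g : nat -> bool) l :
    (forall a, (a < 2 * k + 2)%N -> moment f l a = moment g l a) ->
    (forall a c, (a + c <= k)%N -> moment2 f l a c = moment2 g l a c) ->
  \prod_(i < l) (M + D *+ f i) = \prod_(i < l) (M + D *+ g i).
Proof.
move=> eq1 eq2; rewrite !prod_expansion; congr ((_ + _ + _) * _).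
  by apply: eq_bigr => a _; rewrite eq1.
apply: eq_bigr => a _; apply: eq_bigr => c _.
have [/eq2-> //|lt_k] := leqP (a + c) k.
rewrite (_ : conj_diff a * conj_diff c = 0) ?mul0rn //.
apply: (above_eq0 _ (aboveM (@above_conj_diff a) (@above_conj_diff c))); lia.
Qed.

End Expansion.

(** The function g is an integer-valued polynomial of degree less than d, with
natural coefficients in the binomial basis. *)
Definition binom_span (d : nat) (g : nat -> nat) :=
  exists kappa : nat -> nat,
    forall i, g i = (\sum_(e < d) kappa e * 'C(i, e))%N.

Lemma binom_spanD d g h :
  binom_span d g -> binom_span d h -> binom_span d (fun i => g i + h i)%N.
Proof.
move=> [u gE] [v hE]; exists (fun e => u e + v e)%N => i.
by rewrite gE hE -big_split; apply: eq_bigr => e _; rewrite mulnDl.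
Qed.

Lemma binom_spanW d d' g : (d <= d')%N -> binom_span d g -> binom_span d' g.
Proof.
move=> le_d [u gE]; exists (fun e => (e < d) * u e)%N => i; rewrite gE.
rewrite (big_ord_widen _ (fun e => u e * 'C(i, e))%N le_d) big_mkcond.
by apply: eq_bigr => e _; case: ltnP; rewrite ?mul1n.
Qed.

Lemma binom_span_sum d g : g 0%N = 0%N ->
    binom_span d (fun i => g i.+1 - g i)%N ->
    {homo g : i j / (i <= j)%N} ->
  binom_span d.+1 g.
Proof.
move=> g0 [u gE] gmono; exists (fun e => if e is e'.+1 then u e' else 0%N).
elim=> [|i IHi]; rewrite big_ord_recl mul0n add0n.
  by rewrite g0 big1 // => e _; rewrite bin0n muln0.
rewrite -(subnK (gmono i i.+1 (leqnSn i))) gE IHi big_ord_recl mul0n add0n.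
rewrite addnC -big_split; apply: eq_bigr => e _.
by rewrite /= binS mulnDr.
Qed.

(** The first difference of a product of binomial coefficients is a sum of such
products of smaller degree. *)
Lemma binom_span_mul a c : binom_span (a + c).+1 (fun i => 'C(i, a) * 'C(i, c))%N.
Proof.
have [m] := ubnP (a + c); elim: m a c => // m IHm a c le_m.
have span1 d : binom_span d.+1 (fun i => 'C(i, d)).
  exists (fun e => (e == d)%N : nat) => i.
  rewrite big_ord_recr /= eqxx mul1n big1 // => e _.
  by rewrite ltn_eqF ?mul0n.
case: a c le_m => [|a] [|c] le_m.
- have [u uE] := span1 0%N; exists u => i; rewrite -uE; by rewrite bin0.
- by have [u uE] := span1 c.+1; exists u => i; rewrite add0n -uE bin0 mul1n.
- by have [u uE] := span1 a.+1; exists u => i; rewrite addn0 -uE bin0 muln1.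
apply: binom_span_sum => [//||]; last first.
  move=> i j leij; apply: leq_mul; exact: leq_bin2l.
suff [u uE] : binom_span (a.+1 + c.+1)
    (fun i => 'C(i, a) * 'C(i, c.+1) + 'C(i, a.+1) * 'C(i, c)
                + 'C(i, a) * 'C(i, c))%N.
  by exists u => i; rewrite -uE !binS; lia.
apply: binom_spanD; first apply: binom_spanD.
- by rewrite addSn; apply: IHm; lia.
- by rewrite addnS; apply: IHm; lia.
- by apply: (@binom_spanW (a + c).+1); [lia | apply: IHm; lia].
Qed.

(** Splitting the pairs of positions (i, j) into i < j, i > j and i = j. *)
Lemma moment_mul f l a c :
  (moment f l a * moment f l c =
     moment2 f l a c + moment2 f l c a +
       \sum_(i < l) f i * ('C(i, a) * 'C(i, c)))%N.
Proof.
rewrite /moment2; elim: l => [|l IHl]; first by rewrite /moment !big_ord0.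
rewrite !big_ord_recr /= [moment f l.+1 a]big_ord_recr /=.
rewrite [moment f l.+1 c]big_ord_recr /= -!/(moment f l _) mulnDl !mulnDr IHl.
by case: (f l); rewrite ?mul1n ?mul0n ?muln0; ring.
Qed.

(** The diagonal term of [moment_mul] is a combination of moments, by
[binom_span_mul], so the moments and the double moments below the diagonal
determine the others. *)
Lemma moment2_sym f g l k :
    (forall a, (a < 2 * k + 2)%N -> moment f l a = moment g l a) ->
    (forall a c, (a < c)%N -> (a + c <= k)%N ->
       moment2 f l a c = moment2 g l a c) ->
  forall a c, (a + c <= k)%N -> moment2 f l a c = moment2 g l a c.
Proof.
move=> eq1 eq2 a c le_k.
have eqd : (\sum_(i < l) f i * ('C(i, a) * 'C(i, c)) =
            \sum_(i < l) g i * ('C(i, a) * 'C(i, c)))%N.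
  have [u uE] := binom_span_mul a c.
  have diagE (h : nat -> bool) : (\sum_(i < l) h i * ('C(i, a) * 'C(i, c)) =
      \sum_(e < (a + c).+1) u e * moment h l e)%N.
    under eq_bigr do rewrite uE big_distrr /=.
    rewrite exchange_big; apply: eq_bigr => e _; rewrite big_distrr /=.
    by apply: eq_bigr => i _; rewrite mulnCA.
  rewrite !diagE; apply: eq_bigr => e _; rewrite eq1 //.
  by have := ltn_ord e; lia.
have := moment_mul f l a c; rewrite eqd !eq1; try lia.
rewrite moment_mul => /addIn eqs.
case: (ltngtP a c) eqs => [ac _|ca|->]; first exact: eq2.
  have le_k' : (c + a <= k)%N by rewrite addnC.
  by rewrite (eq2 _ _ ca le_k') => /addIn.
by rewrite !addnn => /double_inj.
Qed.

(** * Replacing letters by blocks *)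

Definition inflate (x y : seq bool) (w : seq bool) : seq bool :=
  flatten [seq if b then x else y | b <- w].

Lemma size_inflate x y w :
  size x = size y -> size (inflate x y w) = (size w * size y)%N.
Proof.
move=> eqs; rewrite size_flatten /shape -map_comp.
elim: w => //= b w ->; rewrite mulSn; congr (_ + _)%N.
by case: b.
Qed.

Lemma inflate_inj x y w w' : size x = size y -> x != y ->
  size w = size w' -> inflate x y w = inflate x y w' -> w = w'.
Proof.
move=> eqs neq; elim: w w' => [|b w IHw] [|b' w'] //= [eqw] /eqP.
rewrite /inflate /= eqseq_cat; last by case: b b' => [] [].
move=> /andP[eqb /eqP/IHw-> //]; congr (_ :: _).
by case: b b' eqb => [] [] //; rewrite ?(negPf neq) // eq_sym (negPf neq).
Qed.

Lemma occ_mx_inflate u x y w :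
  occ_mx u (inflate x y w) =
    \prod_(i < size w)
       (occ_mx u y + (occ_mx u x - occ_mx u y) *+ nth false w i).
Proof.
rewrite -(big_mkord xpredT (fun i => occ_mx u y + _ *+ nth false w i)).
rewrite -(big_nth false xpredT (fun b : bool => occ_mx u y + _ *+ b)).
elim: w => [|b w IHw]; first by rewrite /occ_mx !big_nil.
rewrite /inflate /= occ_mx_cat IHw big_cons; congr (_ * _).
by case: b; rewrite ?addr0 // mulr1n addrC subrK.
Qed.

Lemma deck_eq_inflate k x y w w' : deck_eq k x y -> size w = size w' ->
    (forall a, (a < 2 * k + 2)%N ->
       moment (nth false w) (size w) a = moment (nth false w') (size w) a) ->
    (forall a c, (a < c)%N -> (a + c <= k)%N ->
       moment2 (nth false w) (size w) a c = moment2 (nth false w') (size w) a c) ->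
  deck_eq (3 * k + 2) (inflate x y w) (inflate x y w').
Proof.
move=> eqxy eqs eq1 eq2; apply: deck_eq_mx => u le_u; rewrite !occ_mx_inflate.
have [Mi [MMi MiM upMi]] := above_inv (@above_occ_mx1 u y).
have upD := above_deck_eq (u := u) eqxy.
rewrite -eqs.
apply: (eq_prod_moments le_u MMi MiM (@above_occ_mx1 u y) upMi upD) => //.
exact: moment2_sym.
Qed.

(** * The pigeonhole step *)

(** The pigeonhole principle for a family of functions: pass to a largest fibre of
one function after the other. *)
Lemma joint_collision (T : finType) (I : eqType) (f : I -> T -> nat)
    (bound : I -> nat) (r : seq I) (S : {set T}) :
    (forall i x, (f i x < bound i)%N) ->
    (\prod_(i <- r) bound i < #|S|)%N ->
  exists x y, [/\ x \in S, y \in S, x != y & forall i, i \in r -> f i x = f i y].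
Proof.
move=> f_lt; elim: r S => [|i r IHr] S.
  by rewrite big_nil => /card_gt1P[x [y [Sx Sy neq]]]; exists x, y.
rewrite big_cons => lt_S; pose fiber (v : 'I_(bound i)) := [set x in S | f i x == v].
have [v lt_v] : exists v, (\prod_(j <- r) bound j < #|fiber v|)%N.
  apply/existsP; apply: contraLR lt_S; rewrite negb_exists -leqNgt => /forallP le_v.
  rewrite -sum1_card (partition_big (fun x => Ordinal (f_lt i x)) xpredT) //=.
  rewrite -[X in (_ <= X * _)%N]card_ord -sum_nat_const; apply: leq_sum => v _.
  rewrite leqNgt; apply: contra (le_v v) => /leq_trans; apply.
  by rewrite sum1dep_card; apply: subset_leq_card; apply/subsetP => x; rewrite !inE.
have [x [y [xv yv neq eqr]]] := IHr _ lt_v; exists x, y.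
move: xv yv; rewrite !inE => /andP[Sx /eqP xv] /andP[Sy /eqP yv].
by split=> // j; rewrite inE => /predU1P[->|/eqr//]; rewrite xv yv.
Qed.

Lemma moment_le f l a : (moment f l a <= 'C(l, a.+1))%N.
Proof.
elim: l => [|l IHl]; first by rewrite /moment big_ord0.
rewrite /moment big_ord_recr /= binS leq_add //.
by case: (f l); rewrite ?mul1n.
Qed.

Lemma moment2_le f l a c : (moment2 f l a c <= 'C(l, a.+1) * 'C(l, c.+1))%N.
Proof.
rewrite mulnC; apply: leq_trans (leq_mul (moment_le f l c) (leqnn _)).
rewrite /moment2 /moment big_distrl; apply: leq_sum => j _ /=.
by rewrite leq_mul2l (leq_trans (moment_le f j a)) ?orbT // leq_bin2l // ltnW.
Qed.

(** The exponents (a, c) with a < c and a + c <= k, sorted by their sum. *)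
Definition below_diag (k : nat) : seq (nat * nat) :=
  [seq (a, s - a)%N | s <- iota 0 k.+1, a <- iota 0 (uphalf s)].

Lemma mem_below_diag k a c :
  (a < c)%N -> (a + c <= k)%N -> (a, c) \in below_diag k.
Proof.
move=> ac le_k; apply/allpairsPdep; exists (a + c)%N, a.
by rewrite !mem_iota !add0n; split; rewrite ?addKn //; lia.
Qed.

(** The exponents of the two factors in the bound Y^exp_Y (2 e^(L/Y))^exp_E on the
number of values of the moments: a moment of degree m - 1 takes at most
Y^m (2 e^(L/Y)) values ([bin_succ_le]). *)
Definition exp_Y k := ('C(k + 3, 3) + (k + 1) * (2 * k + 3))%N.
Definition exp_E k := ('C(k + 2, 2) + (2 * k + 2))%N.

Lemma sum_exp_Y k :
  (\sum_(a < 2 * k + 2) a.+1 + \sum_(s < k.+1) uphalf s * (s + 2) <= exp_Y k)%N.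
Proof.
rewrite addnC leq_add //.
  elim: k => [|k IHk]; first by rewrite big_ord_recr big_ord0.
  rewrite big_ord_recr addSn binS leq_add // addn3 bin2 geq_half_double.
  rewrite [nat_of_ord _]/= [k.+3.-1]/= -mul2n mulnA mul2n mulnC.
  by rewrite leq_mul ?addn2 // uphalf_half; have := odd_double_half k.+1; lia.
elim: k => [|k IHk]; first by rewrite !big_ord_recr big_ord0.
have -> : (2 * k.+1 + 2 = (2 * k + 2).+2)%N by lia.
rewrite big_ord_recr big_ord_recr /= -addnA.
by apply: leq_trans (leq_add IHk (leqnn _)) _; nia.
Qed.

Lemma sum_exp_E k :
  (\sum_(a < 2 * k + 2) 1 + \sum_(s < k.+1) uphalf s * 2 <= exp_E k)%N.
Proof.
rewrite addnC leq_add //; last by rewrite sum1_card card_ord.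
elim: k => [|k IHk]; first by rewrite big_ord_recr big_ord0.
rewrite big_ord_recr addSn binS bin1 leq_add // addn2 muln2 [nat_of_ord _]/= uphalf_half.
by have := odd_double_half k.+1; lia.
Qed.

Section RealBounds.
Context {R : realType}.

(** A single term of the binomial expansion of (1 + 1/Y)^L.  A common Y for all m
keeps most of the factor 1/m! in the bound L^m / m!, which is needed for the
final constant. *)
Lemma bin_le_exp (L m : nat) (Y : R) : 0 < Y ->
  'C(L, m)%:R <= Y ^+ m * expR (L%:R / Y).
Proof.
move=> Y0; have [lt_m|le_m] := ltnP L m.
  by rewrite bin_small // mulr_ge0 ?exprn_ge0 ?expR_ge0 // ltW.
have Ym : 0 < Y ^+ m by rewrite exprn_gt0.
rewrite mulrC -ler_pdivrMr //.
apply: (@le_trans _ _ ((1 + Y^-1) ^+ L)); last first.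
  rewrite expRM_natl lerXn2r ?nnegrE ?expR_ge0 ?expR_ge1Dx //.
  by rewrite addr_ge0 ?invr_ge0 // ltW.
rewrite exprDn (bigD1 (Ordinal (le_m : (m < L.+1)%N))) //= expr1n mul1r.
rewrite -[leLHS]addr0 lerD //; first by rewrite exprVn mulrC mulr_natr.
apply: sumr_ge0 => i _; rewrite mulrn_wge0 // expr1n mul1r exprn_ge0 //.
by rewrite invr_ge0 ltW.
Qed.

Lemma bin_succ_le (L m : nat) (Y : R) : 1 <= Y ->
  'C(L, m)%:R + 1 <= Y ^+ m * (2 * expR (L%:R / Y)).
Proof.
move=> Y1; have Y0 : 0 < Y by apply: lt_le_trans Y1.
rewrite mulrCA [leRHS]mulr_natl [leRHS]mulr2n lerD ?bin_le_exp //.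
rewrite -[leLHS]mulr1 ler_pM ?exprn_ege1 //; apply: le_trans (expR_ge1Dx _).
by rewrite lerDl divr_ge0 // ltW.
Qed.

End RealBounds.

(** * Pairs of words with the same deck *)

Definition ambiguous (k N : nat) := exists x y : seq bool,
  [/\ size x = N, size y = N, x != y & deck_eq k x y].

(** When the 2^L words of length L outnumber the possible values of their moments,
two of them agree and are inflated by the given pair. *)
Lemma ambiguous_triple (R : realType) (k N L : nat) (Y : R) : 1 <= Y ->
    (exp_Y k)%:R * ln Y + (exp_E k)%:R * (ln 2 + L%:R / Y) < L%:R * ln 2 ->
  ambiguous k N -> ambiguous (3 * k + 2) (L * N).
Proof.
move=> Y1 lt_L [x [y [sx sy neq eqxy]]].
pose stat (i : nat + nat * nat) (w : L.-tuple bool) : nat := match i with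
  | inl a => moment (nth false w) L a
  | inr p => moment2 (nth false w) L p.1 p.2
  end.
pose bound (i : nat + nat * nat) : nat := match i with
  | inl a => 'C(L, a.+1).+1
  | inr p => ('C(L, p.1.+1) * 'C(L, p.2.+1)).+1
  end.
pose r : seq (nat + nat * nat) :=
  [seq inl a | a <- iota 0 (2 * k + 2)] ++ [seq inr p | p <- below_diag k].
have stat_lt i w : (stat i w < bound i)%N.
  by case: i => [a|p]; rewrite ltnS ?moment_le ?moment2_le.
have [] := @joint_collision _ _ stat bound r [set: L.-tuple bool] stat_lt.
  pose E : R := 2 * expR (L%:R / Y).
  have E0 : 0 < E by rewrite mulr_gt0 ?expR_gt0.
  have Y0 : 0 < Y by apply: lt_le_trans Y1.
  have E1 : 1 <= E.
    have := @bin_succ_le R L 0 Y Y1; rewrite expr0 mul1r bin0 => /(le_trans _); apply.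
    by rewrite lerDl.
  rewrite cardsT card_tuple card_bool -(ltr_nat R) natrX.
  apply: (@le_lt_trans _ _ (Y ^+ exp_Y k * E ^+ exp_E k)); last first.
    rewrite -ltr_ln ?posrE ?mulr_gt0 ?exprn_gt0 //.
    rewrite lnM ?posrE ?exprn_gt0 // !lnXn // lnM ?posrE ?expR_gt0 // expRK.
    rewrite -[ln Y *+ _]mulr_natl -[(ln 2 + _) *+ _]mulr_natl.
    by rewrite -[ln 2 *+ _]mulr_natl; exact: lt_L.
  pose weightY := (\sum_(a < 2 * k + 2) a.+1 + \sum_(s < k.+1) uphalf s * (s + 2))%N.
  pose weightE := (\sum_(a < 2 * k + 2) 1 + \sum_(s < k.+1) uphalf s * 2)%N.
  apply: (@le_trans _ _ (Y ^+ weightY * E ^+ weightE)); last first.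
    by rewrite ler_pM ?exprn_ge0 ?ler_weXn2l ?sum_exp_Y ?sum_exp_E // ltW.
  have bound_inr a c : (bound (inr (a, c)))%:R <= Y ^+ (a + c + 2) * E ^+ 2.
    rewrite /bound /= (_ : (a + c + 2 = a.+1 + c.+1)%N); last by lia.
    rewrite exprD mulrACA -natr1 natrM.
    apply: le_trans (ler_pM _ _ (bin_succ_le L a.+1 Y1) (bin_succ_le L c.+1 Y1)).
    - move: ('C(L, _)%:R) ('C(L, _)%:R) (ler0n R 'C(L, a.+1)) (ler0n R 'C(L, c.+1)).
      by move=> s t s0 t0; nra.
    - by rewrite addr_ge0.
    - by rewrite addr_ge0.
  rewrite big_cat !big_map big_allpairs_dep natrM /weightY /weightE !exprD mulrACA.
  apply: ler_pM => //.
    rewrite -{1}[(2 * k + 2)%N]subn0 -/(index_iota 0 _) big_mkord natr_prod.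
    rewrite !expr_sum -big_split /=; apply: ler_prod => a _.
    by rewrite ler0n -natr1 expr1 bin_succ_le.
  rewrite -{1}[k.+1]subn0 -/(index_iota 0 _) big_mkord natr_prod.
  rewrite !expr_sum -big_split /=; apply: ler_prod => s _; rewrite ler0n.
  rewrite -{1}[uphalf s]subn0 -/(index_iota 0 _) big_mkord natr_prod.
  rewrite ![(uphalf s * _)%N]mulnC !exprM -exprMn.
  rewrite -[X in _ <= _ ^+ X]card_ord -prodr_const; apply: ler_prod => a _.
  rewrite ler0n; have -> : (s + 2 = a + (s - a) + 2)%N; last exact: bound_inr.
  by rewrite subnKC // (leq_trans (ltnW (ltn_ord a))) // leq_uphalf_double; lia.
move=> w [w' [_ _ neqw eqst]]; exists (inflate x y w), (inflate x y w').
have eqxy_size : size x = size y by rewrite sx sy.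
have eqw_size : size w = size w' by rewrite !size_tuple.
split; rewrite ?size_inflate ?size_tuple ?sy //.
  apply: contra neqw => /eqP eqi; apply/eqP/val_inj.
  exact: inflate_inj eqxy_size neq eqw_size eqi.
apply: deck_eq_inflate; rewrite // size_tuple; [move=> a lt_a | move=> a c ac le_k].
  by apply: (eqst (inl a)); rewrite mem_cat map_f // mem_iota.
by apply: (eqst (inr (a, c))); rewrite mem_cat map_f ?orbT // mem_below_diag.
Qed.

(** * From words to permutations *)

Local Open Scope nat_scope.

Lemma sub_in_count (T : eqType) (p q : pred T) (s : seq T) :
  {in s, subpred p q} -> count p s <= count q s.
Proof.
move=> sub; rewrite (@eq_in_count _ p (predI p q)) => [|x xs].
  by apply: sub_count => x /andP[].
by apply/idP/andP => [px|[]//]; split; last exact: sub.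
Qed.

Lemma nth_std s i : i < size s ->
  nth 0 (std s) i = (count (fun j => nth 0 s j < nth 0 s i) (iota 0 (size s))).+1.
Proof.
move=> hi; rewrite (nth_map 0) //; congr _.+1.
by rewrite -{2}(mkseq_nth 0 s) count_map; apply: eq_count.
Qed.

Lemma eq_std s t : size s = size t ->
    (forall i j, i < size s -> j < size s ->
       (nth 0 s i < nth 0 s j) = (nth 0 t i < nth 0 t j)) ->
  std s = std t.
Proof.
move=> eqs eqlt; apply: (@eq_from_nth _ 0); rewrite !size_map // => i hi.
rewrite !nth_std -?eqs //; congr _.+1; apply: eq_in_count => j.
by rewrite mem_iota => /andP[_ hj]; apply: eqlt.
Qed.

(** Distinct numbers that compare like the pairs (letter, position) in
lexicographic order. *)
Definition keys (w : seq bool) : seq nat :=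
  mkseq (fun i => nth false w i * size w + i) (size w).

(** Two increasing runs of values, shuffled as the word prescribes; the inverse is
a Grassmannian permutation. *)
Definition word_perm (w : seq bool) : seq nat := std (keys w).

Lemma size_word_perm w : size (word_perm w) = size w.
Proof. by rewrite !size_map size_iota. Qed.

Lemma keys_lt w i j : i < size w -> j < size w ->
  (nth 0 (keys w) i < nth 0 (keys w) j) =
  if nth false w i == nth false w j then i < j else nth false w j.
Proof.
move=> hi hj; rewrite !nth_mkseq //.
by case: (nth false w i); case: (nth false w j) => /=; lia.
Qed.

Lemma word_perm_lt w i j : i < size w -> j < size w ->
  (nth 0 (word_perm w) i < nth 0 (word_perm w) j) =
  if nth false w i == nth false w j then i < j else nth false w j.
Proof. by move=> hi hj; rewrite std_ltn ?size_mkseq // keys_lt. Qed.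

Lemma word_perm_symn w : word_perm w \in symn (size w).
Proof.
rewrite -[X in symn X](size_mkseq (fun i => nth false w i * size w + i)).
apply/std_symn/(uniqP 0) => i j; rewrite !inE size_mkseq => hi hj eqij.
have := keys_lt hi hj; have := keys_lt hj hi; rewrite eqij ltnn eq_sym.
case: eqP => [_|]; first by case: (ltngtP i j).
by case: (nth _ _ i); case: (nth _ _ j).
Qed.

(** The word is recovered from its permutation and its number of letters false,
which is part of the 1-deck. *)
Lemma nth_word_perm_gt w i : i < size w ->
  (count_mem false w < nth 0 (word_perm w) i) = nth false w i.
Proof.
move=> hi; rewrite nth_std ?size_mkseq // ltnS.
have -> : count_mem false w =
    count (fun j => nth false w j == false) (iota 0 (size w)).
  by rewrite -{1}(mkseq_nth false w) count_map.
case wi: (nth false w i).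
  apply/idP; apply: sub_in_count => j; rewrite mem_iota => /andP[_ hj] /eqP wj.
  by rewrite keys_lt // wj wi.
apply/negbTE; rewrite -ltnNge -addn1.
have -> : 1 = count (pred1 i) (iota 0 (size w)).
  by rewrite count_uniq_mem ?iota_uniq // mem_iota hi.
rewrite -count_predUI (_ : count (predI _ _) _ = 0) ?addn0; last first.
  apply/eqP; rewrite -leqn0 leqNgt -has_count; apply/hasPn => j _ /=.
  by case: eqP => [->|]; rewrite ?ltnn ?andbF.
apply: sub_in_count => j; rewrite mem_iota => /andP[_ hj] /= /orP[|/eqP->].
  by rewrite keys_lt // wi; case: (nth _ _ j).
by rewrite wi.
Qed.

Lemma occ1 w b : occ w [:: b] = count_mem b w.
Proof.
elim: w => //= a w ->; rewrite addnC (_ : occ w [::] = 1) ?muln1 //.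
by elim: w => //= c w ->.
Qed.

Lemma word_perm_inj k w w' : 0 < k -> size w = size w' -> deck_eq k w w' ->
  word_perm w = word_perm w' -> w = w'.
Proof.
move=> k0 eqs eqw eqg; apply: (@eq_from_nth _ false) => // i hi.
rewrite -(nth_word_perm_gt hi) -nth_word_perm_gt -?eqs // eqg.
by rewrite -!occ1 eqw.
Qed.

Definition subword (n : nat) (w : seq bool) (A : {set 'I_n}) : seq bool :=
  [seq nth false w (val i) | i <- enum A].

Lemma sorted_enum_val n (A : {set 'I_n}) : sorted ltn [seq val i | i <- enum A].
Proof.
rewrite sorted_map sorted_filter //; first by move=> j i l; apply: ltn_trans.
by rewrite -sorted_map -enumT val_enum_ord iota_ltn_sorted.
Qed.

(** Comparisons between entries depend only on the letters and on the order of the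
positions, and both are inherited by subwords. *)
Lemma minor_word_perm w (A : {set 'I_(size (word_perm w))}) :
  minor (word_perm w) A = word_perm (subword w A).
Proof.
rewrite /minor; set s := [seq val i | i <- enum A].
have s_lt p : p < size s -> nth 0 s p < size w.
  rewrite size_map => hp; rewrite -(size_word_perm w).
  have [x0 _] : exists x : 'I_(size (word_perm w)), x \in enum A.
    by case: (enum A) hp => // x t _; exists x; rewrite mem_head.
  by rewrite (nth_map x0) ?ltn_ord.
have -> : [seq nth 0 (word_perm w) (val i) | i <- enum A] =
  [seq nth 0 (word_perm w) i | i <- s] by rewrite -map_comp.
have -> : subword w A = [seq nth false w i | i <- s] by rewrite -map_comp.
apply: eq_std => [|p q]; first by rewrite size_mkseq !size_map.
rewrite size_map => hp hq.
have [hp' hq'] : p < size (enum A) /\ q < size (enum A) by rewrite -(size_map val).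
rewrite keys_lt ?size_map //.
rewrite !(nth_map 0 0 (nth 0 (word_perm w))) // word_perm_lt ?s_lt //.
rewrite !(nth_map 0 false (nth false w)) //; case: ifP => // _.
have [lt_pq|le_qp] := ltnP p q.
  exact: (sorted_ltn_nth ltn_trans 0 (sorted_enum_val A)).
apply/negbTE; rewrite -leqNgt; have := sorted_enum_val A.
rewrite -/s ltn_sorted_uniq_leq => /andP[_ /(sorted_leq_nth leq_trans leqnn 0)].
by apply.
Qed.

Fixpoint bitseqs (n : nat) : seq (seq bool) :=
  if n is n'.+1 then
    [seq true :: v | v <- bitseqs n'] ++ [seq false :: v | v <- bitseqs n']
  else [:: [::]].

Lemma mem_bitseqs n v : (v \in bitseqs n) = (size v == n).
Proof.
elim: n v => [|n IHn] [|b v] //=.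
  rewrite mem_cat; apply/norP; split; apply/mapP; by case.
have cons_inj c : injective (cons c : seq bool -> _) by move=> ? ? [].
rewrite mem_cat eqSS -IHn; case: b; last rewrite orbC;
  rewrite mem_map //; case: (v \in _) => //=; apply/mapP; by case.
Qed.

Lemma uniq_bitseqs n : uniq (bitseqs n).
Proof.
have cons_inj c : injective (cons c : seq bool -> _) by move=> ? ? [].
elim: n => //= n IHn; rewrite cat_uniq !map_inj_uniq // IHn andbT.
by apply/hasPn => _ /mapP[v _ ->]; apply/mapP; case.
Qed.

Lemma count_mask_bitseqs w u :
  count (fun v => mask v w == u) (bitseqs (size w)) = occ w u.
Proof.
elim: w u => [|a w IHw] u /=; first by rewrite addn0; case: u.
rewrite count_cat !count_map addnC; congr (_ + _); first exact: IHw.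
case: u => [|b u]; first by rewrite -(count_pred0 (bitseqs (size w))); apply: eq_count.
rewrite -IHw; case: eqP => [->|neq].
  by rewrite mul1n; apply: eq_count => v /=; rewrite eqseq_cons eqxx.
rewrite mul0n -(count_pred0 (bitseqs (size w))); apply: eq_count => v /=.
by rewrite eqseq_cons; case: eqP.
Qed.

(** Sets of positions correspond to bit masks. *)
Lemma count_subword w u :
  count (fun A : {set 'I_(size w)} => subword w A == u)
    (enum {set 'I_(size w)}) = occ w u.
Proof.
pose bits (A : {set 'I_(size w)}) := [seq i \in A | i <- enum 'I_(size w)].
have subE A : subword w A = mask (bits A) w.
  rewrite -[w in RHS](mkseq_nth false) /mkseq -val_enum_ord -map_comp -map_mask.
  by rewrite -filter_mask enumT.
have perm_bits : perm_eq [seq bits A | A <- enum {set 'I_(size w)}] (bitseqs (size w)).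
  apply: uniq_perm; rewrite ?uniq_bitseqs //.
    rewrite map_inj_uniq ?enum_uniq // => A B /eq_in_map eqAB.
    by apply/setP => i; apply: eqAB; rewrite mem_enum.
  move=> v; rewrite mem_bitseqs; apply/mapP/eqP => [[A _ ->]|sv].
    by rewrite size_map size_enum_ord.
  exists [set i : 'I_(size w) | nth false v i]; rewrite ?mem_enum //.
  rewrite -[LHS](mkseq_nth false) sv /mkseq -val_enum_ord -map_comp.
  by apply: eq_map => i /=; rewrite inE.
rewrite -count_mask_bitseqs -(permP perm_bits) [RHS]count_map.
by apply: eq_count => A /=; rewrite subE.
Qed.

Lemma deck_word_perm k w w' : size w = size w' -> deck_eq k w w' ->
  perm_eq (deck k (word_perm w)) (deck k (word_perm w')).
Proof.
move=> eqs eqw.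
pose words n (v : seq bool) :=
  [seq subword v A | A : {set 'I_n} <- enum {set 'I_n} & #|A| == k].
have deckE v : deck k (word_perm v) = [seq word_perm u | u <- words (size v) v].
  rewrite -(size_word_perm v) -map_comp.
  by apply: eq_map => A; apply: minor_word_perm.
have count_words v u : count_mem u (words (size v) v) = (size u == k) * occ v u.
  rewrite count_map count_filter -count_subword.
  have [su|nu] := eqVneq (size u) k; last first.
    rewrite mul0n -(count_pred0 (enum {set 'I_(size v)})); apply: eq_count => A /=.
    apply: contraNF nu => /andP[/eqP <- /eqP <-].
    by rewrite size_map -cardE.
  rewrite mul1n; apply: eq_count => A /=; have [eqA|//] := eqVneq (subword v A) u.
  have -> : #|A| = k by rewrite -su -eqA size_map cardE.
  by rewrite eqxx.
rewrite !deckE perm_map //; apply/allP => u _ /=; rewrite !count_words.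
by have [su|_] := eqVneq (size u) k; rewrite ?mul0n // eqw ?su.
Qed.

Local Close Scope nat_scope.

Lemma ambiguous_leq k k' N : (k' <= k)%N -> ambiguous k N -> ambiguous k' N.
Proof.
move=> le_k [x [y [sx sy neq eqxy]]]; exists x, y; split=> // u le_u.
by apply: eqxy; apply: leq_trans le_k.
Qed.

Lemma deck_eq_cat k x y z : deck_eq k x y -> deck_eq k (x ++ z) (y ++ z).
Proof.
move=> eqxy; apply: deck_eq_mx => u le_u; rewrite !occ_mx_cat; congr (_ * _).
by apply/eqP; rewrite -subr_eq0 (above_eq0 _ (above_deck_eq eqxy)).
Qed.

Lemma ambiguous_pad k N n : (N <= n)%N -> ambiguous k N -> ambiguous k n.
Proof.
move=> le_n [x [y [sx sy neq eqxy]]]; pose z := nseq (n - N) true.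
exists (x ++ z), (y ++ z); rewrite !size_cat size_nseq sx sy subnKC //; split=> //.
  by apply: contra neq; rewrite eqseq_cat ?sx // => /andP[].
exact: deck_eq_cat.
Qed.

Lemma ambiguous_double k N : ambiguous k N -> ambiguous k.+1 (2 * N).
Proof.
move=> [x [y [sx sy neq eqxy]]]; exists (x ++ y), (y ++ x).
rewrite !size_cat sx sy mul2n addnn; split=> //; last exact: deck_eq_swap.
by apply: contra neq; rewrite eqseq_cat ?sx // => /andP[].
Qed.

(** * A pair of words of length 32 with the same 6-deck *)

(** Counting the occurrences of all the suffixes of u together, in binary
arithmetic, makes the equality of two explicit decks computable. *)
Fixpoint occ_tails (w u : seq bool) : seq nat :=
  occ w u :: if u is _ :: u' then occ_tails w u' else [::].

Fixpoint read_letter (a : bool) (u : seq bool) (r : seq BinNums.N) : seq BinNums.N :=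
  match u, r with
  | b :: u', c :: r' =>
      (if a == b then BinNat.N.add c (head BinNums.N0 r') else c) :: read_letter a u' r'
  | _, _ => r
  end.

Fixpoint occ_table (w u : seq bool) : seq BinNums.N :=
  if w is a :: w' then read_letter a u (occ_table w' u)
  else rcons (nseq (size u) BinNums.N0) (BinNums.Npos BinNums.xH).

Lemma nat_of_binD (p q : BinNums.N) :
  nat_of_bin (BinNat.N.add p q) = (nat_of_bin p + nat_of_bin q)%N.
Proof. by case: p q => [|p] [|q] //=; rewrite ?addn0 // nat_of_add_pos. Qed.

Lemma occ_tableE w u : [seq nat_of_bin c | c <- occ_table w u] = occ_tails w u.
Proof.
elim: w => [|a w IHw] /=.
  by elim: u => //= b u ->.
elim: u (occ_table w u) IHw => [|b u IHu] [|c r] //=.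
  by case: r => [[<-]|] //=; rewrite addn0.
move=> [eqc eqr]; rewrite -(IHu r) //; congr (_ :: _).
case: eqP => _; last by rewrite mul0n addn0.
rewrite mul1n nat_of_binD eqc; congr (_ + _)%N.
by case: r u eqr {IHu eqc} => [|d r] [|b' u] //= [].
Qed.

Lemma occ_head_table w u : occ w u = head BinNums.N0 (occ_table w u).
Proof.
by have := occ_tableE w u; case: u => [|b u]; case: (occ_table _ _) => [|c r] //= [->].
Qed.

(** The inflations of this word and of its reversal by 01 and 10 have the same
6-deck. *)
Definition seed16 : seq bool :=
  [:: true; false; false; false; false; true; true; true;
      false; false; false; false; false; true; true; false].

Definition seed32 (w : seq bool) := inflate [:: false; true] [:: true; false] w.

Lemma ambiguous_6_32 : ambiguous 6 32.
Proof.
exists (seed32 seed16), (seed32 (rev seed16)); split; [by [] | by [] | by [] |].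
move=> u le_u.
rewrite !occ_head_table; congr nat_of_bin; apply/eqP.
have /allP/(_ u) : all (fun v => head BinNums.N0 (occ_table (seed32 seed16) v) ==
                           head BinNums.N0 (occ_table (seed32 (rev seed16)) v))
    (flatten [seq bitseqs m | m <- iota 0 7]) by vm_compute.
apply; apply/flattenP; exists (bitseqs (size u)); last by rewrite mem_bitseqs.
by apply: map_f; rewrite mem_iota add0n ltnS.
Qed.

Lemma ambiguous_pow2 k : (5 <= k)%N -> ambiguous k (2 ^ maxn 5 k.-1).
Proof.
have amb6 m : ambiguous (6 + m) (2 ^ (5 + m)).
  elim: m => [|m IHm]; first exact: ambiguous_6_32.
  by rewrite !addnS expnS; apply: ambiguous_double.
case: (leqP 6 k) => [le_k _|lt_k ge_k].
  rewrite -(subnKC le_k) addSn /=; move: (k - 6)%N => m.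
  by rewrite (maxn_idPr _) ?leq_addr //; apply: amb6.
have -> : k = 5%N by lia.
exact: (ambiguous_leq (isT : (5 <= 6)%N) ambiguous_6_32).
Qed.

(** The Thue-Morse word of length 16 and its complement. *)
Lemma ambiguous_4_16 : ambiguous 4 16.
Proof.
suff : ambiguous 1 2 by do 3 move/ambiguous_double.
by exists [:: false; true], [:: true; false]; split=> // -[|[] [|? ?]].
Qed.

(** * Numerical estimates *)

Section Growth.
Context {R : realType}.
Implicit Types (k N j L : nat).

Lemma ln_natX m e : (0 < m)%N -> ln (m%:R ^+ e : R) = e%:R * ln m%:R.
Proof. by move=> m0; rewrite lnXn ?ltr0n // mulr_natl. Qed.

Lemma ln3_gt0 : 0 < ln 3 :> R.
Proof. by apply: ln_gt0; lra. Qed.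

(** The convergent 53/84 of log_3 2 from above: 2^84 <= 3^53. *)
Lemma ln2_le_ln3 : 84 * ln 2 <= 53 * ln 3 :> R.
Proof. by rewrite -!ln_natX // ler_ln ?posrE ?exprn_gt0 //; lra. Qed.

Lemma ln2_ge : 69 / 100 <= ln 2 :> R.
Proof.
rewrite -ler_expR lnK ?posrE // -[leRHS]invrK -[leLHS]invrK lef_pV2 ?posrE //;
  rewrite ?invr_gt0 ?expR_gt0 //.
rewrite -expRN (_ : - (69 / 100) = 128%:R * (- (69 / 12800))); last by lra.
rewrite expRM_natl.
apply: (@le_trans _ _ ((12731 / 12800) ^+ 128)); first by lra.
rewrite lerXn2r ?nnegrE ?expR_ge0 //; first by lra.
by apply: le_trans (expR_ge1Dx _); lra.
Qed.

Lemma ln2_le : ln 2 <= 7 / 10 :> R.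
Proof.
rewrite -ler_expR lnK ?posrE //.
rewrite (_ : 7 / 10 = 64%:R * (7 / 640)); last by lra.
rewrite expRM_natl.
apply: (@le_trans _ _ ((647 / 640) ^+ 64)); first by lra.
rewrite lerXn2r ?nnegrE ?expR_ge0 //; first by lra.
by apply: le_trans (expR_ge1Dx _); lra.
Qed.

(** The inequality log_3 N <= 1.52 (log_3 k)^2, without denominators. *)
Definition within k N := (0 < N)%N /\
  ln N%:R * ln 3 <= 38 / 25 * ln k%:R ^+ 2 :> R.

Lemma within_leq k k' N : (0 < k <= k')%N -> within k N -> within k' N.
Proof.
case/andP=> k0 le_k [N0 le_N]; split=> //; apply: le_trans le_N _.
have k0' := leq_trans k0 le_k.
have lnk : ln k%:R <= ln k'%:R :> R by rewrite ler_ln ?posrE ?ltr0n ?ler_nat.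
have ln0 : 0 <= ln k%:R :> R by rewrite ln_ge0 ?ler1n.
by rewrite ler_pM2l ?lerXn2r ?nnegrE ?(le_trans ln0) //; lra.
Qed.

(** The hypothesis says that p/45 + c bounds log_3 k from below; 45 is large enough
to separate 2^16 from the bound at k = 17. *)
Lemma within_pow k (e b p c : nat) :
    (p + 45 * c)%:R * ln 3 <= 45 * ln k%:R :> R ->
    (e%:R * (53 / 84) + b%:R : R) <= 38 / 25 * (p%:R / 45 + c%:R) ^+ 2 ->
  within k (2 ^ e * 3 ^ b).
Proof.
move=> le_k le_p; split; first by rewrite muln_gt0 !expn_gt0.
have l3 := ln3_gt0; have l2 := ln2_le_ln3.
rewrite natrM !natrX lnM ?posrE ?exprn_gt0 // !ln_natX //.
have le1 : e%:R * ln 2 + b%:R * ln 3 <= (e%:R * (53 / 84) + b%:R) * ln 3 :> R.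
  rewrite mulrDl lerD2r -mulrA ler_wpM2l //; lra.
apply: le_trans (ler_wpM2r (ltW l3) le1) _.
apply: (@le_trans _ _ (38 / 25 * (p%:R / 45 + c%:R) ^+ 2 * (ln 3 * ln 3))).
  by rewrite -[leLHS]mulrA ler_wpM2r // mulr_ge0 ?ltW.
have le_lnk : (p%:R / 45 + c%:R) * ln 3 <= ln k%:R :> R.
  by move: le_k; rewrite natrD natrM; lra.
have ge0 : 0 <= (p%:R / 45 + c%:R) * ln 3 :> R.
  by rewrite mulr_ge0 ?addr_ge0 ?divr_ge0 // ltW.
rewrite (_ : _ * (_ * _) = 38 / 25 * ((p%:R / 45 + c%:R) * ln 3) ^+ 2); last by ring.
apply: ler_wpM2l; first by lra.
by rewrite lerXn2r ?nnegrE // (le_trans ge0).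
Qed.

Lemma ln_pow_le k p : (0 < k)%N -> 3 ^+ p <= k%:R ^+ 45 :> R ->
  p%:R * ln 3 <= 45 * ln k%:R :> R.
Proof. by move=> k0 le_p; rewrite -!ln_natX // ler_ln ?posrE ?exprn_gt0 ?ltr0n. Qed.

(** Since log_3 (3k) = log_3 k + 1, the target grows by 1.52 (2 log_3 k + 1) from k
to 3k. *)
Lemma within_step k L N : within k N -> (0 < L)%N ->
    ln L%:R <= 38 / 25 * ln 3 + 76 / 25 * ln k%:R :> R ->
    (0 < k)%N ->
  within (3 * k) (L * N).
Proof.
move=> [N0 le_N] L0 le_L k0; split; first by rewrite muln_gt0 L0.
rewrite !natrM !lnM ?posrE ?ltr0n // mulrDl.
have := ler_wpM2r (ltW ln3_gt0) le_L; move: le_N.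
by move: (ln N%:R) (ln L%:R) (ln k%:R) (ln 3) => n l x y; nra.
Qed.

Lemma exp_YE k : (exp_Y k)%:R =
  (k%:R + 1) * (k%:R + 2) * (k%:R + 3) / 6 + (k%:R + 1) * (2 * k%:R + 3) :> R.
Proof.
have h : ('C(k + 3, 3) * 6 = (k + 1) * (k + 2) * (k + 3))%N.
  by rewrite (bin_ffact _ 3) !ffactnS ffactn0 addn3 /=; lia.
have : ('C(k + 3, 3) * 6)%:R = ((k + 1) * (k + 2) * (k + 3))%:R :> R by rewrite h.
by rewrite /exp_Y !(natrD, natrM); lra.
Qed.

Lemma exp_EE k : (exp_E k)%:R =
  (k%:R + 1) * (k%:R + 2) / 2 + (2 * k%:R + 2) :> R.
Proof.
have h : ('C(k + 2, 2) * 2 = (k + 1) * (k + 2))%N.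
  by rewrite (bin_ffact _ 2) !ffactnS ffactn0 addn2 /=; lia.
have : ('C(k + 2, 2) * 2)%:R = ((k + 1) * (k + 2))%:R :> R by rewrite h.
by rewrite /exp_E !(natrD, natrM); lra.
Qed.

End Growth.

Section LargeStepInequality.
Context {R : realType}.

Lemma ln_le_tangent (a x : R) : 0 < a -> 0 < x -> ln x <= ln a + (x / a - 1).
Proof.
move=> a0 x0; have xa0 : 0 < x / a by rewrite divr_gt0.
rewrite -{1}(divfK (lt0r_neq0 a0) x) lnM ?posrE // addrC lerD2l.
have e1 : 1 + (x / a - 1) = x / a by rewrite addrC subrK.
by have := @le_ln1Dx R (x / a - 1); rewrite e1; apply; lra.
Qed.

(** Here J = k, y = ln k, x = k^0.04 and l = ln 2; the left-hand side bounds
the logarithm of the number of moment values at Y = 16 k^2.04, and the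
right-hand side that of the number of words.  After division by J^2 the
leading terms are J (0.34 y + 0.63) against 3.657 J x.  The two lower bounds
on x are tangents to k^0.04 as a function of y, the second one with a rounded
constant: the tangent at y = 0 serves for k <= 256 and that at y = 22, near the
point where the inequality is tightest, beyond.  The terms of lower order
contain y without a factor J, and are controlled by the tangents to the
logarithm at 16 and 256. *)
Lemma large_step_ineq (J y x l : R) : 18 <= J -> 69 / 100 <= l -> l <= 7 / 10 ->
    0 <= y -> y <= 4 * l + (J / 16 - 1) ->
    (J <= 256 -> y <= 8 * l) -> (256 <= J -> y <= 8 * l + (J / 256 - 1)) ->
    1 + y / 25 <= x -> 47 / 20 * (3 / 25 + y / 25) <= x ->
  ((J + 1) * (J + 2) * (J + 3) / 6 + (J + 1) * (2 * J + 3)) *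
     (4 * l + 51 / 25 * y) +
  ((J + 1) * (J + 2) / 2 + (2 * J + 2)) * (l + J / 3) <
  (53 / 10 * J ^+ 3 * x - 1) * l.
Proof.
move=> J18 l_ge l_le y0 y16 y_small y_large x1 x2.
have J2 : 18 * J <= J ^+ 2 by rewrite expr2; nra.
have J3 : 0 <= J ^+ 3 by rewrite exprn_ge0; lra.
have J2p : 324 <= J ^+ 2 by lra.
have A_le : (J + 1) * (J + 2) * (J + 3) / 6 + (J + 1) * (2 * J + 3) <=
    J ^+ 2 * (J / 6 + 17 / 5).
  by rewrite -subr_ge0 (_ : _ - _ = 2 / 5 * J ^+ 2 - 41 / 6 * J - 4); [lra | field].
have B_le : ((J + 1) * (J + 2) / 2 + (2 * J + 2)) * (l + J / 3) <=
    J ^+ 2 * (J / 6 + 43 / 25).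
  apply: (@le_trans _ _ (((J + 1) * (J + 2) / 2 + (2 * J + 2)) * (7 / 10 + J / 3))).
    by apply: ler_wpM2l; [nra | lra].
  rewrite -subr_ge0.
  by rewrite (_ : _ - _ = 61 / 300 * J ^+ 2 - 69 / 20 * J - 21 / 10); [lra | field].
have A_le' : ((J + 1) * (J + 2) * (J + 3) / 6 + (J + 1) * (2 * J + 3)) *
     (4 * l + 51 / 25 * y) <= J ^+ 2 * ((J / 6 + 17 / 5) * (14 / 5 + 51 / 25 * y)).
  rewrite mulrA; apply: ler_pM => //; [| lra | lra].
  by rewrite addr_ge0 ?divr_ge0 ?mulr_ge0 //; lra.
have C_ge : J ^+ 2 * (3657 / 1000 * J * x) - 7 / 10 <= (53 / 10 * J ^+ 3 * x - 1) * l.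
  have x0 : 0 <= x by lra.
  have z0 := mulr_ge0 J3 x0; rewrite -[53 / 10 * _ * x]mulrA.
  rewrite (_ : J ^+ 2 * (3657 / 1000 * J * x) = 3657 / 1000 * (J ^+ 3 * x)).
    by move: (J ^+ 3 * x) z0 => z z0; nra.
  by ring.
suff main : (J / 6 + 17 / 5) * (14 / 5 + 51 / 25 * y) + (J / 6 + 43 / 25) + 1 / 100
     <= 3657 / 1000 * J * x.
  have J20 : 0 <= J ^+ 2 by lra.
  have := ler_wpM2l J20 main; rewrite !mulrDr; lra.
have Jy0 : 0 <= J * y by rewrite mulr_ge0 //; lra.
have J0 : 0 <= J by lra.
have Jx1 := ler_wpM2l J0 x1; have Jx2 := ler_wpM2l J0 x2.
have [J_le|/ltW J_ge] := leP J 256.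
  have Jy := ler_wpM2l J0 (y_small J_le).
  have Jl : J * l <= J * (7 / 10) by apply: ler_wpM2l.
  by move: Jy0 Jx1 Jy Jl; rewrite !mulrDr; lra.
have yl := y_large J_ge.
by move: Jy0 Jx2; rewrite !mulrDr; lra.
Qed.

End LargeStepInequality.

Section LargeStep.
Context {R : realType}.

(** The hypotheses of [ambiguous_triple] on L and Y. *)
Definition words_outnumber (k L : nat) (Y : R) := 1 <= Y /\
  (exp_Y k)%:R * ln Y + (exp_E k)%:R * (ln 2 + L%:R / Y) < L%:R * ln 2.

(** The choice L = floor(3^1.52 j^3.04) is the largest that the target allows; Y is
close to 3L/j, up to replacing 3^1.52 by 16/3. *)
Lemma large_step (j : nat) : (18 <= j)%N -> exists L Y,
  [/\ (0 < L)%N, ln L%:R <= 38 / 25 * ln 3 + 76 / 25 * ln j%:R :> R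
    & words_outnumber j L Y].
Proof.
move=> j18; pose J : R := j%:R; pose y := ln J.
have J18 : 18 <= J by rewrite (ler_nat R 18).
have J0 : 0 < J by lra.
have y0 : 0 <= y by rewrite ln_ge0; lra.
have l3 := @ln3_gt0 R; have l_ge := @ln2_ge R; have l_le := @ln2_le R.
have ey : expR y = J by rewrite lnK.
pose t := expR (38 / 25 * ln 3) : R.
have t_ge : 53 / 10 <= t.
  rewrite -[leLHS]lnK ?posrE; last by lra.
  rewrite ler_expR; have : ln ((53 / 10) ^+ 25) <= ln (3 ^+ 38) :> R.
    by rewrite ler_ln ?posrE ?exprn_gt0; lra.
  by rewrite !lnXn ?divr_gt0 // -[_ *+ 25]mulr_natl -[_ *+ 38]mulr_natl; lra.
have t_le : t <= 16 / 3.
  rewrite -[leRHS]lnK ?posrE; last by lra.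
  rewrite ler_expR; have : ln (3 ^+ 38) <= ln ((16 / 3) ^+ 25) :> R.
    by rewrite ler_ln ?posrE ?exprn_gt0; lra.
  by rewrite !lnXn ?divr_gt0 // -[_ *+ 25]mulr_natl -[_ *+ 38]mulr_natl; lra.
pose x := expR (y / 25).
have x1 : 1 + y / 25 <= x by apply: expR_ge1Dx.
have x2 : 47 / 20 * (3 / 25 + y / 25) <= x.
  (* The tangent at y = 22, with e^0.88 bounded below by 1.055^16. *)
  have -> : x = expR (16%:R * (55 / 1000)) * expR (y / 25 - 22 / 25).
    by rewrite -expRD; congr expR; lra.
  have -> : 3 / 25 + y / 25 = 1 + (y / 25 - 22 / 25) by lra.
  apply: ler_pM; [lra | lra | | exact: expR_ge1Dx].
  rewrite expRM_natl; apply: (@le_trans _ _ ((1055 / 1000) ^+ 16)); first by lra.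
  by rewrite lerXn2r ?nnegrE ?expR_ge0 //; have := @expR_ge1Dx R (55 / 1000); lra.
pose Z := expR (38 / 25 * ln 3 + 76 / 25 * y).
have ZE : Z = t * (J ^+ 3 * x).
  rewrite /Z expRD; congr (_ * _); rewrite -ey -expRM_natl -expRD.
  by congr expR; lra.
have Z1 : 1 <= Z.
  by apply: le_trans (expR_ge1Dx _); lra.
have /andP[L_le L_gt] : (Num.trunc Z)%:R <= Z < (Num.trunc Z).+1%:R.
  by apply: truncn_itv; lra.
set L := Num.trunc Z in L_le L_gt.
have L0 : (0 < L)%N by rewrite -ltnS -(ltr_nat R); apply: le_lt_trans L_gt.
exists L, (16 * expR (51 / 25 * y)).
have L0R : 0 < L%:R :> R by rewrite ltr0n.
have Y1 : 1 <= 16 * expR (51 / 25 * y).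
  have := @expR_ge1Dx R (51 / 25 * y); lra.
split=> //; first by rewrite -[leRHS]expRK ler_ln ?posrE ?expR_gt0.
split=> //; rewrite lnM ?posrE ?expR_gt0 // expRK.
have -> : ln 16 = 4 * ln 2 :> R.
  by rewrite (_ : 16 = 2 ^+ 4) ?lnXn ?mulr_natl //; lra.
have LY : L%:R / (16 * expR (51 / 25 * y)) <= J / 3.
  rewrite ler_pdivrMr ?mulr_gt0 ?expR_gt0 //; apply: le_trans L_le _.
  have -> : Z = t * J * expR (51 / 25 * y).
    by rewrite -ey /Z -!expRD; congr expR; lra.
  rewrite mulrA ler_wpM2r ?expR_ge0 //.
  by have := ler_wpM2r (ltW J0) t_le; lra.
have tangent m : (0 < m)%N -> y <= ln m%:R + (J / m%:R - 1).
  by move=> m0; apply: ln_le_tangent => //; rewrite ltr0n.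
have ln_pow2 e : ln (2 ^ e)%:R = e%:R * ln 2 :> R by rewrite natrX ln_natX.
have y16 : y <= 4 * ln 2 + (J / 16 - 1).
  by rewrite -(ln_pow2 4%N); apply: (tangent 16%N).
have y256 : 256 <= J -> y <= 8 * ln 2 + (J / 256 - 1).
  by move=> _; rewrite -(ln_pow2 8%N); apply: (tangent 256%N).
have ys : J <= 256 -> y <= 8 * ln 2.
  by move=> J_le; rewrite -(ln_pow2 8%N) ler_ln ?posrE.
apply: le_lt_trans (_ : _ <= (exp_Y j)%:R * (4 * ln 2 + 51 / 25 * y) +
  (exp_E j)%:R * (ln 2 + J / 3)) _.
  by rewrite lerD2l ler_wpM2l // lerD2l.
rewrite exp_YE exp_EE.
apply: lt_le_trans (large_step_ineq J18 l_ge l_le y0 y16 ys y256 x1 x2) _.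
rewrite ler_wpM2r //; first by lra.
have x0 : 0 <= J ^+ 3 * x by rewrite mulr_ge0 ?expR_ge0 ?exprn_ge0 // ltW.
have := ler_wpM2r x0 t_ge; rewrite -ZE mulrA -natr1 in L_gt *; lra.
Qed.

End LargeStep.

Section SmallSteps.
Context {R : realType}.

(** For 6 <= j <= 17 the pair of length 2^(j-1) is used, with L = 2^a 3^b.  Powers
of 2 and 3 make the logarithm of L explicit; p/45 approximates log_3 j from
below.  The second condition is the target at j, the third the target at 3j.
In the last one Y = 2048 is a power of 2 of the order of 3L/j. *)
Definition good_row (j p a b : nat) : Prop :=
  [/\ 3 ^+ p <= j%:R ^+ 45 :> R,
      j.-1%:R * (53 / 84) <= 38 / 25 * (p%:R / 45) ^+ 2 :> R,
      (j.-1 + a)%:R * (53 / 84) + b%:R <= 38 / 25 * (p%:R / 45 + 1) ^+ 2 :> R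
    & words_outnumber j (2 ^ a * 3 ^ b) (2048 : R)].

Lemma small_table j : (6 <= j <= 17)%N -> exists p a b, good_row j p a b.
Proof.
have ln2048 : ln 2048 = 11 * ln 2 :> R.
  by rewrite (_ : 2048 = 2 ^+ 11) ?lnXn ?mulr_natl //; lra.
have l_ge := @ln2_ge R.
have row i p a b : 3 ^+ p <= i%:R ^+ 45 :> R ->
    i.-1%:R * (53 / 84) <= 38 / 25 * (p%:R / 45) ^+ 2 :> R ->
    (i.-1%:R + a%:R) * (53 / 84) + b%:R <= 38 / 25 * (p%:R / 45 + 1) ^+ 2 :> R ->
    ((i%:R + 1) * (i%:R + 2) * (i%:R + 3) / 6 + (i%:R + 1) * (2 * i%:R + 3)) *
      (11 * ln 2) +
    ((i%:R + 1) * (i%:R + 2) / 2 + (2 * i%:R + 2)) *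
      (ln 2 + 2 ^+ a * 3 ^+ b / 2048) < 2 ^+ a * 3 ^+ b * ln 2 :> R ->
  exists p a b, good_row i p a b.
  move=> h1 h2 h3 h4; exists p, a, b; split; rewrite // ?natrD //; split; first by lra.
  by rewrite exp_YE exp_EE ln2048 natrM !natrX.
have : (j < 18)%N -> (6 <= j)%N -> exists p a b, good_row j p a b; last first.
  by move=> h /andP[h6 h17]; apply: h.
do 6! case: j => // j.
case: j => [_ _|j].
  by apply: (row 6%N 73%N 8%N 2%N); rewrite /=; lra.
case: j => [_ _|j].
  by apply: (row 7%N 79%N 12%N 0%N); rewrite /=; lra.
case: j => [_ _|j].
  by apply: (row 8%N 85%N 11%N 1%N); rewrite /=; lra.
case: j => [_ _|j].
  by apply: (row 9%N 90%N 13%N 0%N); rewrite /=; lra.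
case: j => [_ _|j].
  by apply: (row 10%N 94%N 13%N 0%N); rewrite /=; lra.
case: j => [_ _|j].
  by apply: (row 11%N 98%N 14%N 0%N); rewrite /=; lra.
case: j => [_ _|j].
  by apply: (row 12%N 101%N 14%N 0%N); rewrite /=; lra.
case: j => [_ _|j].
  by apply: (row 13%N 105%N 14%N 0%N); rewrite /=; lra.
case: j => [_ _|j].
  by apply: (row 14%N 108%N 13%N 1%N); rewrite /=; lra.
case: j => [_ _|j].
  by apply: (row 15%N 110%N 8%N 4%N); rewrite /=; lra.
case: j => [_ _|j].
  by apply: (row 16%N 113%N 13%N 1%N); rewrite /=; lra.
case: j => [_ _|j].
  by apply: (row 17%N 116%N 13%N 1%N); rewrite /=; lra.
by [].
Qed.

End SmallSteps.

(** Strong induction along k |-> k / 3.  The target is met already at 3j, although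
the pair obtained from j serves up to 3j + 2. *)
Lemma ambiguous_within (R : realType) (k : nat) : (5 <= k)%N ->
  exists N, ambiguous k N /\ @within R k N.
Proof.
have [m] := ubnP k; elim: m k => // m IHm k lt_k k5.
have [k17|k18] := leqP k 17.
  exists (2 ^ maxn 5 k.-1)%N; split; first exact: ambiguous_pow2.
  have pow_within (p : nat) : 3 ^+ p <= k%:R ^+ 45 :> R ->
      (maxn 5 k.-1)%:R * (53 / 84) <= 38 / 25 * (p%:R / 45) ^+ 2 :> R ->
    @within R k (2 ^ maxn 5 k.-1).
    move=> le_p le_e; rewrite -[(2 ^ _)%N]muln1 -[X in (_ * X)%N](expn0 3).
    apply: (@within_pow R k (maxn 5 k.-1) 0 p 0); rewrite ?addr0 //.
    by rewrite muln0 addn0; apply: ln_pow_le => //; apply: leq_trans k5.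
  have [k6|lt6] := leqP 6 k.
    have [|p [a [b [le_p le_e _ _]]]] := @small_table R k; first by rewrite k6.
    by apply: (pow_within p) => //; rewrite (maxn_idPr _) //; case: (k) k6.
  apply: (pow_within 65%N); have -> : k = 5%N by apply/eqP; rewrite eqn_leq k5 -ltnS lt6.
    by lra.
  by rewrite (_ : maxn 5 5.-1 = 5%N) //; lra.
pose j := (k %/ 3)%N; have le_j : (3 * j <= k <= 3 * j + 2)%N by rewrite /j; lia.
have /andP[le3j lek] := le_j; have j6 : (6 <= j)%N by lia.
have j0 : (0 < 3 * j)%N by lia.
suff [N [ambN withinN]] : exists N, ambiguous (3 * j + 2) N /\ @within R (3 * j) N.
  exists N; split; first exact: ambiguous_leq ambN.
  by apply: within_leq withinN; rewrite j0.
have [j17|j18] := leqP j 17.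
  have [|p [a [b [le_p _ le_e [Y1 few]]]]] := @small_table R j; first by rewrite j6.
  exists (2 ^ a * 3 ^ b * 2 ^ j.-1)%N; split.
    apply: ambiguous_triple Y1 few _.
    by have := @ambiguous_pow2 j (ltnW j6); rewrite (maxn_idPr _) //; case: (j) j6.
  rewrite mulnAC -expnD addnC; apply: (@within_pow R _ _ b p 1) => //.
  have j_gt0 : (0 < j)%N by lia.
  have := ln_pow_le j_gt0 le_p.
  by rewrite muln1 natrD natrM lnM ?posrE ?ltr0n //; lra.
have [L [Y [L0 le_L [Y1 few]]]] := @large_step R j j18.
have [||N [ambN withinN]] := IHm j; [by lia | by lia |].
exists (L * N)%N; split; first exact: ambiguous_triple Y1 few ambN.
by apply: within_step => //; lia.
Qed.

(** * The lower bound *)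

Lemma ambiguous_recon_num (n k : nat) : (0 < n)%N -> ambiguous k n ->
  (recon_num n <= k)%N -> False.
Proof.
move=> n0 [x [y [sx sy neq eqxy]]] le_k.
have [/andP[r0 _] /allP rec _] := recon_numP n0.
have eqr u : (size u <= recon_num n)%N -> occ x u = occ y u.
  by move=> le_u; apply: eqxy; apply: leq_trans le_k.
have hx := word_perm_symn x; have hy := word_perm_symn y.
rewrite sx in hx; rewrite sy in hy.
have /allP/(_ _ hy)/implyP nperm := rec _ hx.
have sxy : size y = size x by rewrite sx sy.
have eqyx : deck_eq (recon_num n) y x by move=> u le_u; rewrite eqr.
have neqg : word_perm y != word_perm x.
  apply: contra neq => /eqP eqg; apply/eqP/esym.
  exact: word_perm_inj r0 sxy eqyx eqg.
by move/negP: (nperm neqg); apply; apply: deck_word_perm.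
Qed.

Theorem mainTheorem1 (R : realType) (n : nat) (hn : (16 <= n)%N) :
  3 `^ (811 / 1000 * Num.sqrt (log3 n.+1%:R)) <= (recon_num n)%:R :> R.
Proof.
have n0 : (0 < n)%N by apply: leq_trans hn.
rewrite leNgt; apply/negP => lt_r.
set k := recon_num n in lt_r.
have [k4|k5] := leqP k 4.
  exact: (ambiguous_recon_num n0 (ambiguous_pad hn ambiguous_4_16) k4).
have [N [ambN [N0 le_N]]] := @ambiguous_within R k k5.
suff leNn : (N <= n)%N.
  exact: (ambiguous_recon_num n0 (ambiguous_pad leNn ambN) (leqnn k)).
have k1 : (0 < k)%N by apply: leq_trans k5.
have l3 := @ln3_gt0 R.
rewrite -ltnS -(ltr_nat R) -ltr_ln ?posrE ?ltr0n //.
have lnk0 : 0 <= ln k%:R :> R by rewrite ln_ge0 ?ler1n.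
have lnn0 : 0 < ln n.+1%:R :> R by rewrite ln_gt0 // ltr1n.
have log0 : 0 <= log3 n.+1%:R :> R by rewrite divr_ge0 // ltW.
have lnk_lt : ln k%:R < 811 / 1000 * Num.sqrt (log3 n.+1%:R) * ln 3 :> R.
  by rewrite -ln_powR ltr_ln ?posrE ?powR_gt0 ?ltr0n.
have := ltr_pM lnk0 lnk0 lnk_lt lnk_lt.
rewrite -!expr2.
have -> : (811 / 1000 * Num.sqrt (log3 n.+1%:R) * ln 3) ^+ 2 =
    (811 / 1000) ^+ 2 * (ln n.+1%:R * ln 3) :> R.
  rewrite 2!exprMn sqr_sqrtr // -mulrA; congr (_ * _).
  by rewrite expr2 mulrA divfK // lt0r_neq0.
(* 1.52 * 0.811^2 = 0.99973... *)
move=> lt_sq; rewrite -(ltr_pM2r l3); apply: le_lt_trans le_N _.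
have := mulr_gt0 lnn0 l3; lra.
Qed.
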